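(* $R(K_{2,5}, K_{3,5})\geq 20$, where $R$ denotes the two-color Ramsey number and $K_{m,n}$ denotes the complete bipartite graph with parts of sizes $m$ and $n$.
   Context: All graphs are finite, simple and undirected. For graphs $G_1, G_2$, the two-color Ramsey number $R(G_1,G_2)$ is the least integer $n$ such that for any edge-coloring of the complete graph $K_n$ with 2 colors there exists some $i\in\{1,2\}$ such that the subgraph of $K_n$ formed by the edges of color $i$ contains a copy of $G_i$ as a (not necessarily induced) subgraph. *)

(* Defs.v *)
From mathcomp Require Import all_boot.

Set Implicit Arguments.
Unset Strict Implicit.
Unset Printing Implicit Defensive.

Record sgraph := SGraph {
  vertex :> finType;
  adj : rel vertex;
  adj_sym : symmetric adj;
  adj_irr : irreflexive adj
}.

Definition is_edge (G : sgraph) (e : {set G}) : bool :=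
  [exists x : G, exists y : G, adj x y && (e == [set x; y])].

Definition edge (G : sgraph) : finType := {e : {set G} | is_edge e}.

Lemma complete_sym n : symmetric (fun x y : 'I_n => x != y).
Proof. by move=> x y; rewrite eq_sym. Qed.

Lemma complete_irr n : irreflexive (fun x y : 'I_n => x != y).
Proof. by move=> x; rewrite eqxx. Qed.

Definition complete (n : nat) : sgraph :=
  SGraph (@complete_sym n) (@complete_irr n).

Definition bip_adj (m n : nat) : rel ('I_m + 'I_n)%type := fun x y =>
  match x, y with
  | inl _, inr _ | inr _, inl _ => true
  | _, _ => false
  end.

Lemma bip_sym m n : symmetric (@bip_adj m n).
Proof. by case=> x [] y. Qed.

Lemma bip_irr m n : irreflexive (@bip_adj m n).
Proof. by case=> x. Qed.

Definition complete_bipartite (m n : nat) : sgraph :=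
  SGraph (@bip_sym m n) (@bip_irr m n).

(* H contains a copy of G, not necessarily induced. *)
Definition contains_copy (H G : sgraph) : bool :=
  [exists f : {ffun G -> H},
     injectiveb f && [forall x, forall y, adj x y ==> adj (f x) (f y)]].

(* The two colors are the two booleans. *)
Definition coloring (G : sgraph) := {ffun edge G -> bool}.

Section ColorSubgraph.
Variables (G : sgraph) (c : coloring G) (i : bool).

Definition color_adj : rel G := fun x y =>
  [exists e : edge G, (val e == [set x; y]) && (c e == i)].

Lemma color_adj_sym : symmetric color_adj.
Proof. by move=> x y; rewrite /color_adj setUC. Qed.

Lemma color_adj_irr : irreflexive color_adj.
Proof.
move=> x; apply/existsP => -[[e /= he]] /andP[/eqP ee _].
case/existsP: he => y /existsP[z] /andP[yz /eqP eyz].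
have: y \in [set x; x] by rewrite -ee eyz set21.
have: z \in [set x; x] by rewrite -ee eyz set22.
by rewrite setUid !inE => /eqP zx /eqP yx; rewrite yx zx adj_irr in yz.
Qed.

Definition color_subgraph : sgraph := SGraph color_adj_sym color_adj_irr.

End ColorSubgraph.

Definition arrows (n : nat) (G1 G2 : sgraph) : bool :=
  [forall c : coloring (complete n),
     contains_copy (color_subgraph c false) G1
     || contains_copy (color_subgraph c true) G2].

Section RamseyTheorem.

Let homog (T : finType) (r : rel T) (b : bool) (A B : {set T}) (k : nat) :=
  [/\ B \subset A, #|B| = k &
      forall x y, x \in B -> y \in B -> x != y -> r x y = b].

Lemma ramsey_sets (s t : nat) : exists N : nat,
  forall (T : finType) (r : rel T) (A : {set T}), symmetric r -> N <= #|A| ->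
    (exists B, homog r false A B s) \/ (exists B, homog r true A B t).
Proof.
have h0 T r b (A : {set T}) : homog r b A set0 0.
  by split; rewrite ?sub0set ?cards0 // => x y; rewrite inE.
have ext T r b (A B : {set T}) k x : symmetric r -> x \in A ->
    homog r b [set y in A :\ x | r x y == b] B k ->
    homog r b A (x |: B) k.+1.
  move=> sr xA [sBA cB hB].
  have inB y : y \in B -> [/\ y != x, y \in A & r x y = b].
    by move/(subsetP sBA); rewrite !inE => /andP[/andP[-> ->] /eqP].
  split.
  - by apply/subsetP => y /setU1P[->|/inB[]].
  - rewrite cardsU1 cB; case: (boolP (x \in B)) => // /inB[].
    by rewrite eqxx.
  - move=> y z /setU1P[->|yB] /setU1P[->|zB]; rewrite ?eqxx // => yz.
    + by case: (inB _ zB).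
    + by rewrite sr; case: (inB _ yB).
    + exact: hB.
elim: s t => [|s IHs] t; first by exists 0 => T r A _ _; left; exists set0.
elim: t => [|t [N2 IH2]]; first by exists 0 => T r A _ _; right; exists set0.
have [N1 IH1] := IHs t.+1.
exists (N1 + N2).+1 => T r A sr leA.
have /card_gt0P[x xA] : 0 < #|A| by apply: leq_trans leA.
pose S b := [set y in A :\ x | r x y == b].
have sSA b : S b \subset A by apply/subsetP => y; rewrite !inE => /andP[/andP[]].
have cS : N1 + N2 <= #|S false| + #|S true|.
  rewrite (cardsD1 x) xA add1n ltnS in leA; apply: leq_trans leA _.
  apply: leq_trans (leq_card_setU _ _).
  apply/subset_leq_card/subsetP => y yA.
  by rewrite !inE in yA *; rewrite yA; case: (r x y).
have wk b (D : bool) (B : {set T}) k : homog r D (S b) B k -> homog r D A B k.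
  by case=> h ? ?; split=> //; apply: subset_trans h (sSA b).
have [le1|lt1] := leqP N1 #|S false|.
  have [[B hB]|[B hB]] := IH1 _ _ _ sr le1.
    by left; exists (x |: B); apply: ext.
  by right; exists B; apply: wk hB.
have le2 : N2 <= #|S true|.
  rewrite leqNgt; apply/negP => lt2.
  by have := leq_add lt1 (ltnW lt2); rewrite addSn ltnNge cS.
have [[B hB]|[B hB]] := IH2 _ _ _ sr le2.
  by left; exists B; apply: wk hB.
by right; exists (x |: B); apply: ext.
Qed.

Lemma clique_contains_copy (H G : sgraph) (B : {set H}) : #|B| = #|G| ->
  (forall x y, x \in B -> y \in B -> x != y -> adj x y) -> contains_copy H G.
Proof.
move=> cB hB; pose f (u : G) : H := enum_val (cast_ord (esym cB) (enum_rank u)).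
have fI : injective f by move=> u v /enum_val_inj/cast_ord_inj/enum_rank_inj.
apply/existsP; exists [ffun u => f u]; apply/andP; split.
  by apply/injectiveP => u v; rewrite !ffunE => /fI.
apply/forallP => u; apply/forallP => v; apply/implyP => uv; rewrite !ffunE.
apply: hB; rewrite ?enum_valP // (inj_eq fI).
by apply/eqP => e; rewrite e adj_irr in uv.
Qed.

Theorem ramsey (G1 G2 : sgraph) : exists n, arrows n G1 G2.
Proof.
have [N hN] := ramsey_sets #|G1| #|G2|.
exists N; apply/forallP => c.
have col b x y : x != y -> color_adj c true x y = b -> color_adj c b x y.
  case: b => // xy /negbT; rewrite negb_exists => /forallP nE.
  have exy : is_edge (G := complete N) [set x; y].
    by apply/existsP; exists x; apply/existsP; exists y; rewrite /= xy eqxx.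
  pose e : edge (complete N) := Sub [set x; y] exy.
  apply/existsP; exists e; have := nE e.
  by rewrite /= eqxx /= => /negPf; case: (c _).
have [||[B [_ cB hB]]|[B [_ cB hB]]] := hN _ (color_adj c true) [set: 'I_N].
- exact: color_adj_sym.
- by rewrite cardsT card_ord.
- apply/orP; left.
  apply: (@clique_contains_copy (color_subgraph c false) _ B cB) => x y xB yB xy.
  by apply: col => //; apply: hB.
- apply/orP; right.
  apply: (@clique_contains_copy (color_subgraph c true) _ B cB) => x y xB yB xy.
  by apply: col => //; apply: hB.
Qed.

End RamseyTheorem.

Definition ramsey_number (G1 G2 : sgraph) : nat := ex_minn (ramsey G1 G2).

(* Main.v *)
Require Import Defs.
From mathcomp Require Import all_boot.

(** The lower bound is witnessed by a circulant coloring of the complete graph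
    on Z/19: an edge gets the first color when its endpoints differ by
    ±1, ±2, ±3 or ±8, and the second color otherwise.  A finite computation
    shows that two vertices have at most 4 common neighbours in the first color,
    and three vertices at most 4 in the second. *)

(** The images of the left part serve as [s]; those of the right part are [n] distinct common
    neighbours. *)
Lemma bipartite_common_neighbours (m n : nat) (H : sgraph) :
  contains_copy H (complete_bipartite m n) ->
  exists s : seq H, [/\ uniq s, size s = m &
    n <= #|[set v : H | all (fun x => adj x v) s]|].
Proof.
case/existsP=> f /andP[/injectiveP f_inj /forallP f_adj].
exists [seq f (inl i) | i : 'I_m]; split.
- by rewrite map_inj_uniq ?enum_uniq // => i j /f_inj[].
- by rewrite size_map size_enum_ord.
- have fr_inj : injective (fun j : 'I_n => f (inr j)) by move=> i j /f_inj[].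
  rewrite -[n in n <= _]card_ord -(card_codom fr_inj).
  apply/subset_leq_card/subsetP => _ /codomP[j ->]; rewrite inE.
  apply/allP => _ /mapP[i _ ->].
  by have /forallP/(_ (inr j)) := f_adj (inl i).
Qed.

(** Vertices are plain numbers so that the count can be evaluated by computation. The conjunct
    [x != v] rules out loops, since [r x x == b] may hold. *)
Definition common_color_count (N : nat) (r : rel nat) (b : bool) (s : seq nat) :=
  count (fun v => all (fun x => (x != v) && (r x v == b)) s) (iota 0 N).

Definition avoids_bipartite (N : nat) (r : rel nat) (b : bool) (m n : nat) :=
  forall s : seq nat, uniq s -> size s = m -> {subset s <= iota 0 N} ->
    common_color_count N r b s < n.

(** An edge is an unordered pair, hence the search for endpoints; for symmetric [r] either order
    gives the same color. *)
Definition rel_coloring (N : nat) (r : rel nat) : coloring (complete N) :=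
  [ffun e : edge (complete N) =>
    [exists x : 'I_N, exists y : 'I_N, (val e == [set x; y]) && r x y]].

Lemma rel_coloring_adj (N : nat) (r : rel nat) (b : bool) (x y : 'I_N) :
  symmetric r -> color_adj (rel_coloring N r) b x y ->
  (x != y :> nat) && (r x y == b).
Proof.
move=> r_sym xy; apply/andP; split.
  by apply: contraTneq xy => /val_inj ->; rewrite color_adj_irr.
case/existsP: xy => e /andP[/eqP e_xy /eqP <-]; rewrite ffunE e_xy.
apply/eqP; apply/idP/existsP => [rxy|[u /existsP[v /andP[/eqP uv ruv]]]].
  by exists x; apply/existsP; exists y; rewrite eqxx.
have : x \in [set u; v] by rewrite -uv set21.
have : y \in [set u; v] by rewrite -uv set22.
have : u \in [set x; y] by rewrite uv set21.
have : v \in [set x; y] by rewrite uv set22.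
rewrite !inE.
(* The four memberships force [(u, v)] to be [(x, y)] or [(y, x)]; symmetry settles the swapped
   case. *)
by do 4![case/orP=> /eqP ?]; subst; rewrite // r_sym.
Qed.

Lemma avoids_bipartite_no_copy (N k : nat) (r : rel nat) (b : bool) (m n : nat) :
  k <= N -> symmetric r -> avoids_bipartite N r b m n ->
  ~~ contains_copy (color_subgraph (rel_coloring k r) b) (complete_bipartite m n).
Proof.
move=> le_kN r_sym r_avoids; apply/negP.
case/bipartite_common_neighbours=> s [s_uniq s_size]; apply/negP; rewrite -ltnNge.
pose t := [seq val x | x : 'I_k <- s].
have t_sub : {subset t <= iota 0 N}.
  by move=> _ /mapP[x _ ->]; rewrite mem_iota /= (leq_trans (ltn_ord x)).
have := r_avoids t; rewrite map_inj_uniq; last exact: val_inj.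
move=> /(_ s_uniq); rewrite size_map => /(_ s_size t_sub).
(* Common neighbours below [k] are among those counted below [N], so the tail of [iota 0 N] is
   dropped. *)
apply: leq_ltn_trans; rewrite /common_color_count -(subnKC le_kN) iotaD count_cat.
apply: leq_trans (leq_addr _ _); rewrite -val_enum_ord count_map.
rewrite cardE enumT /enum_mem size_filter.
apply: sub_count => v; rewrite !inE /= all_map => /allP sv.
by apply/allP => x /sv; exact: rel_coloring_adj.
Qed.

(** If the Ramsey number [k] were at most [N], restricting [r] to the numbers below [k] would color
    [complete k] with neither copy. This covers every [k <= N] at once, without monotonicity of
    [arrows]. *)
Lemma ltn_ramsey_number (N : nat) (r : rel nat) (m n m' n' : nat) :
  symmetric r ->
  avoids_bipartite N r false m n -> avoids_bipartite N r true m' n' ->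
  N < ramsey_number (complete_bipartite m n) (complete_bipartite m' n').
Proof.
move=> r_sym r_false r_true; rewrite /ramsey_number.
case: ex_minnP => k k_arrows _; rewrite ltnNge; apply: contraL k_arrows => le_kN.
apply/forallPn; exists (rel_coloring k r); rewrite negb_or.
by rewrite !(@avoids_bipartite_no_copy N).
Qed.

(* On {0, ..., 18} this is the set ±4, ±5, ±6, ±7, ±9 of differences modulo 19;
   one of the two truncated subtractions is always 0. *)
Definition circulant19 : rel nat := fun x y =>
  (x - y) + (y - x) \in [:: 4; 5; 6; 7; 9; 10; 12; 13; 14; 15].

Lemma circulant19_sym : symmetric circulant19.
Proof. by move=> x y; rewrite /circulant19 addnC. Qed.

Lemma circulant19_pairs : avoids_bipartite 19 circulant19 false 2 5.
Proof.
case=> [|x [|y []]] //= /andP[xy _] _ s_sub.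
(* The claim becomes a closed boolean test over all ordered pairs of residues, with equal entries
   exempted. *)
have check : all (fun x => all (fun y => (x == y) ||
    (common_color_count 19 circulant19 false [:: x; y] < 5))
  (iota 0 19)) (iota 0 19) by vm_compute.
move/allP: check => /(_ x (s_sub x _)); rewrite !inE eqxx => /(_ isT).
move=> /allP/(_ y (s_sub y _)); rewrite !inE eqxx orbT => /(_ isT).
by rewrite inE in xy; rewrite (negPf xy).
Qed.

Lemma circulant19_triples : avoids_bipartite 19 circulant19 true 3 5.
Proof.
case=> [|x [|y [|z []]]] //= s_uniq _ s_sub.
have check : all (fun x => all (fun y => all (fun z =>
    [|| x == y, x == z, y == z |
      common_color_count 19 circulant19 true [:: x; y; z] < 5])
  (iota 0 19)) (iota 0 19)) (iota 0 19) by vm_compute.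
move/allP: check => /(_ x (s_sub x _)); rewrite !inE eqxx => /(_ isT).
move=> /allP/(_ y (s_sub y _)); rewrite !inE eqxx orbT => /(_ isT).
move=> /allP/(_ z (s_sub z _)); rewrite !inE eqxx !orbT => /(_ isT).
move: s_uniq; rewrite !inE negb_or andbT => /andP[/andP[xy xz] yz].
by rewrite (negPf xy) (negPf xz) (negPf yz).
Qed.

Theorem theorem3p2 :
  20 <= ramsey_number (complete_bipartite 2 5) (complete_bipartite 3 5).
Proof.
exact: ltn_ramsey_number circulant19_sym circulant19_pairs circulant19_triples.
Qed.
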